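(* Let $\mathbb{F}$ be any field of characteristic $0$ and let $n\geq 1$ be an integer. Then every symmetric biderivation $\delta$ of the Witt algebra $\mathcal{W}^+_n=\mathrm{Der}(\mathbb{F}[t_1,\ldots,t_n])$ is trivial, i.e. $\delta(x,y)=0$ for all $x,y\in\mathcal{W}^+_n$.
   Context: For a Lie algebra $L$ over a field $\mathbb{F}$, a biderivation of $L$ is an $\mathbb{F}$-bilinear map $\delta:L\times L\to L$ such that for all $x,y,z\in L$: $\delta([x,y],z)=[x,\delta(y,z)]-[y,\delta(x,z)]$ and $\delta(x,[y,z])=[\delta(x,y),z]+[y,\delta(x,z)]$. It is a symmetric biderivation if moreover $\delta(x,y)=\delta(y,x)$ for all $x,y\in L$. $\mathcal{W}^+_n$ is the Lie algebra of $\mathbb{F}$-derivations of the polynomial algebra $A_n=\mathbb{F}[t_1,\ldots,t_n]$. With $d_i=\frac{\partial}{\partial t_i}$ we have $\mathcal{W}^+_n=\bigoplus_{i=1}^n A_n d_i$ and $[fd_i,gd_j]=fd_i(g)d_j-gd_j(f)d_i$ for $f,g\in A_n$. *)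

(* Defs.v *)
From HB Require Import structures.
From mathcomp Require Import all_boot all_order all_algebra.
From mathcomp Require Import boolp functions.
From mathcomp Require Import mpoly.

Set Implicit Arguments.
Unset Strict Implicit.
Unset Printing Implicit Defensive.

Import GRing.Theory.

Local Open Scope ring_scope.

HB.mixin Record Lmodule_isLieAlgebra (F : fieldType) L of GRing.Lmodule F L := {
  lie_bracket : L -> L -> L;
  lie_bracket_bilinear : bilinear_for *:%R *:%R lie_bracket;
  lie_bracketxx : forall x, lie_bracket x x = 0;
  lie_jacobi : forall x y z,
    lie_bracket x (lie_bracket y z) + lie_bracket y (lie_bracket z x)
      + lie_bracket z (lie_bracket x y) = 0
}.

#[short(type="lieAlgType")]
HB.structure Definition LieAlgebra (F : fieldType) :=
  {L of GRing.Lmodule F L & Lmodule_isLieAlgebra F L}.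

Notation "[ 'lie' x , y ]" := (lie_bracket x y)
  (at level 0, format "[ 'lie'  x ,  y ]") : ring_scope.

Section Biderivations.
Variables (F : fieldType) (L : lieAlgType F).
Implicit Type delta : L -> L -> L.

Definition biderivation delta : Prop :=
  [/\ bilinear_for *:%R *:%R delta,
      forall x y z, delta [lie x, y] z = [lie x, delta y z] - [lie y, delta x z]
    & forall x y z, delta x [lie y, z] = [lie delta x y, z] + [lie y, delta x z]].

Definition symmetric_biderivation delta : Prop :=
  biderivation delta /\ forall x y, delta x y = delta y x.

End Biderivations.

(* Der(A), as a subspace of the F-linear space of all functions A -> A, with  *)
(* the commutator bracket.                                                    *)
Section Derivations.
Variables (F : fieldType) (A : algType F).

Definition is_derivation (D : A -> A) : Prop :=
  linear D /\ forall f g, D (f * g) = D f * g + f * D g.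

Definition derivation_pred : pred (A -> A) := fun D => `[< is_derivation D >].

Record der := Der { der_fun :> A -> A; derP : der_fun \in derivation_pred }.

HB.instance Definition _ := [isSub for der_fun].
HB.instance Definition _ := [Choice of der by <:].

Lemma derivation_submod_closed : submod_closed derivation_pred.
Proof.
split=> [|a D E /asboolP[Dl DM] /asboolP[El EM]]; apply/asboolP; split.
- by move=> c f g; rewrite /= scaler0 addr0.
- by move=> f g; rewrite /= mul0r mulr0 addr0.
- move=> c f g; rewrite !fctE Dl El !scalerDr !scalerA mulrC.
  by rewrite addrACA.
- move=> f g; rewrite !fctE DM EM scalerDr mulrDl mulrDr.
  by rewrite scalerAl scalerAr addrACA.
Qed.

HB.instance Definition _ :=
  GRing.isSubmodClosed.Build F (A -> A) derivation_pred derivation_submod_closed.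
HB.instance Definition _ := [SubChoice_isSubLmodule of der by <:].

Lemma der_linear (D : der) : linear D.
Proof. by have /asboolP[] := derP D. Qed.

Lemma derM (D : der) f g : D (f * g) = D f * g + f * D g.
Proof. by have /asboolP[_] := derP D; apply. Qed.

HB.instance Definition _ (D : der) :=
  GRing.isLinear.Build F A A *:%R (der_fun D) (der_linear D).

Lemma derE (D E : der) : D =1 E -> D = E.
Proof. by move=> DE; apply/val_inj/funext. Qed.

Lemma der_addE (D E : der) f : (D + E) f = D f + E f. Proof. by []. Qed.
Lemma der_scaleE a (D : der) f : (a *: D) f = a *: D f. Proof. by []. Qed.

Lemma commutator_derivation (D E : der) :
  (fun f => D (E f) - E (D f)) \in derivation_pred.
Proof.
apply/asboolP; split=> [c f g|f g].
  by rewrite !der_linear scalerBr opprD addrACA.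
rewrite !derM !linearD /= !derM mulrBl mulrBr !opprD.
rewrite [LHS](AC ((2*2)*(2*2)) (((1*5)*(4*8))*((2*7)*(3*6)))) /=.
by rewrite !subrr !addr0.
Qed.

Definition der_bracket (D E : der) : der := Der (commutator_derivation D E).

Lemma der_bracket_bilinear : bilinear_for *:%R *:%R der_bracket.
Proof.
split=> G c D E; apply: derE => f /=; rewrite ?der_linear;
  by rewrite !fctE scalerBr opprD addrACA.
Qed.

Lemma der_bracketxx D : der_bracket D D = 0.
Proof. by apply: derE => f /=; rewrite subrr. Qed.

Lemma der_jacobi D E G :
  der_bracket D (der_bracket E G) + der_bracket E (der_bracket G D)
    + der_bracket G (der_bracket D E) = 0.
Proof.
apply: derE => f; rewrite !der_addE /= !raddfB /=.
rewrite !opprK [LHS](AC (((2*2)*(2*2))*(2*2))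
  ((1*11)*(8*2)*(5*3)*(4*10)*(9*7)*(12*6))) /=.
by rewrite !subrr !addr0.
Qed.

HB.instance Definition _ := Lmodule_isLieAlgebra.Build F der
  der_bracket_bilinear der_bracketxx der_jacobi.

End Derivations.

Definition witt (F : fieldType) (n : nat) : lieAlgType F := der {mpoly F[n]}.

(* Main.v *)
Require Import Defs.
From mathcomp Require Import all_boot all_order all_algebra.
From mathcomp Require Import boolp functions.
From mathcomp Require Import mpoly.
From mathcomp Require Import ring.

(* Expanding delta([x,u],[y,v]) with the two Leibniz rules in either order
   gives [biderivation_swap].  With d_i, t_i d_i, t_i^2 d_i and their products
   as arguments it forces delta(d_i, d_k) = 0, next delta(d_i, t_i d_l) = 0 and
   delta(d_k, [d_l, x]) = 0; since every field is a bracket [d_l, x] (integrate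
   in characteristic 0), delta(d_k, _) = 0.  Then delta commutes with the ad d_k
   in each variable, and the identity makes all values of delta commute with
   every d_m, so delta([d_m, x], y) = [d_m, delta(x, y)] = 0. *)

Set Implicit Arguments.
Unset Strict Implicit.
Unset Printing Implicit Defensive.

Import GRing.Theory.

Local Open Scope ring_scope.

(** * Lie bracket identities and the exchange identity for biderivations *)

Section LieBracket.
Variables (F : fieldType) (L : lieAlgType F).
Implicit Types x y z : L.

Lemma lieDr x y z : [lie x, y + z] = [lie x, y] + [lie x, z].
Proof.
by have [_ /(_ x 1 y z)] := @lie_bracket_bilinear F L; rewrite /= !scale1r.
Qed.

Lemma lieDl x y z : [lie x + y, z] = [lie x, z] + [lie y, z].
Proof.
by have [/(_ z 1 x y) + _] := @lie_bracket_bilinear F L; rewrite /= !scale1r.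
Qed.

Lemma lie0r x : [lie x, 0] = 0.
Proof. by apply: (addrI [lie x, 0]); rewrite -lieDr !addr0. Qed.

Lemma lie0l x : [lie 0, x] = 0.
Proof. by apply: (addrI [lie 0, x]); rewrite -lieDl !addr0. Qed.

Lemma lieNr x y : [lie x, - y] = - [lie x, y].
Proof. by apply: (addrI [lie x, y]); rewrite -lieDr !subrr lie0r. Qed.

Lemma lieNl x y : [lie - x, y] = - [lie x, y].
Proof. by apply: (addrI [lie x, y]); rewrite -lieDl !subrr lie0l. Qed.

Lemma lieC x y : [lie x, y] = - [lie y, x].
Proof.
apply/eqP; rewrite -addr_eq0; apply/eqP.
have := lie_bracketxx (x + y); rewrite lieDl !lieDr !lie_bracketxx.
by rewrite add0r addr0.
Qed.

Lemma lie_leibniz x y z :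
  [lie x, [lie y, z]] = [lie [lie x, y], z] + [lie y, [lie x, z]].
Proof.
apply/eqP; rewrite -subr_eq0 -(lie_jacobi x y z) opprD addrAC addrA.
by rewrite (lieC z [lie x, y]) (lieC z x) lieNr.
Qed.

Lemma biderivation_swap (delta : L -> L -> L) (u v x y : L) :
  biderivation delta ->
  [lie delta u y, [lie x, v]] + [lie [lie x, y], delta u v] =
  [lie delta x y, [lie u, v]] + [lie [lie u, y], delta x v].
Proof.
case=> _ Dl Dr.
have := Dr [lie x, u] y v; rewrite {1}Dl !Dr !Dl !lieDr !lieDl !lieNl !lieNr.
(* Splitting the nested brackets of one expansion makes all four terms of the other appear in it;
   these cancel, and what is left is the identity. *)
rewrite (lie_leibniz x (delta u y) v) (lie_leibniz x y (delta u v)).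
rewrite (lie_leibniz u (delta x y) v) (lie_leibniz u y (delta x v)).
rewrite [X in _ - X](AC (2*2) ((2*3)*(1*4))).
rewrite [X in X - _](AC (2*2) ((2*3)*(1*4))).
rewrite opprD [LHS]addrACA.
move=> /(canRL (addrK _)) /= E; apply: subr0_eq.
by rewrite E addrACA -opprD subrr.
Qed.

End LieBracket.

Lemma natmulS_eq0 (F : fieldType) (V : lmodType F) (k : nat) (v : V) :
  [pchar F] =i pred0 -> v *+ k.+1 = 0 -> v = 0.
Proof.
move=> /pcharf0P F0 /eqP; rewrite -scaler_nat scaler_eq0 F0 /=.
by move/eqP.
Qed.

(** * Partial derivatives of polynomials and their surjectivity *)

Section PolynomialDerivative.
Variables (F : fieldType) (n : nat).
Implicit Types (i j : 'I_n) (p : {mpoly F[n]}).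

Lemma mderivU i j : ('X_i : {mpoly F[n]})^`M(j) = (i == j)%:R.
Proof.
rewrite mderivX mnm1E; case: eqP => [->|_]; last by rewrite scale0r.
by rewrite -{1}[U_(j)%MM]add0m addmK mpolyX0 scale1r.
Qed.

Lemma mderiv1 j : (1 : {mpoly F[n]})^`M(j) = 0.
Proof. by rewrite -mpolyC1 mderivC. Qed.

Lemma mderiv_nat (k : nat) j : (k%:R : {mpoly F[n]})^`M(j) = 0.
Proof. by rewrite mderivMn mderiv1 mul0rn. Qed.

Lemma mderiv_surj i p :
  [pchar F] =i pred0 -> exists q : {mpoly F[n]}, q^`M(i) = p.
Proof.
move=> /pcharf0P F0; elim/mpolyind: p => [|c m p _ _ [q <-]].
  by exists 0; rewrite mderiv0.
exists ((c / (m i).+1%:R) *: 'X_[m + U_(i)] + q).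
rewrite mderivD mderivZ mderivX addmK scalerA mnmDE mnm1E eqxx addn1.
by rewrite mulfVK // F0.
Qed.

End PolynomialDerivative.

(** * Polynomial vector fields and brackets with the [partial i] *)

Section WittAlgebra.
Variables (F : fieldType) (n : nat).
Implicit Types (i j k l : 'I_n) (f g : {mpoly F[n]}) (D E : witt F n).

Lemma vecfield_is_derivation f i :
  (fun g => f * g^`M(i)) \in @derivation_pred F {mpoly F[n]}.
Proof.
apply/asboolP; split=> [c g h|g h] /=.
  by rewrite mderivD mderivZ mulrDr scalerAr.
by rewrite mderivM; ring.
Qed.

Definition vecfield f i : witt F n := Der (vecfield_is_derivation f i).

Lemma vecfieldE f i g : vecfield f i g = f * g^`M(i). Proof. by []. Qed.

Lemma lieE D E f : [lie D, E] f = D (E f) - E (D f). Proof. by []. Qed.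

Lemma witt0E f : (0 : witt F n) f = 0. Proof. by []. Qed.

Lemma wittDE D E f : (D + E) f = D f + E f. Proof. by []. Qed.

Lemma wittNE D f : (- D) f = - D f. Proof. by []. Qed.

Lemma witt_add D f g : D (f + g) = D f + D g. Proof. exact: raddfD. Qed.

Lemma witt_opp D f : D (- f) = - D f. Proof. exact: raddfN. Qed.

Lemma witt_mul D f g : D (f * g) = D f * g + f * D g. Proof. exact: derM. Qed.

Lemma witt_1 D : D 1 = 0.
Proof.
by apply: (addrI (D 1)); rewrite -{3}[1]mulr1 witt_mul mulr1 mul1r addr0.
Qed.

Lemma witt_0 D : D 0 = 0. Proof. exact: raddf0. Qed.

Lemma witt_nat D (k : nat) : D k%:R = 0.
Proof. by rewrite raddfMn /= witt_1 mul0rn. Qed.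

(** The variables generate the algebra, so linearity and the Leibniz rule carry agreement from them
    to every monomial and polynomial. Equalities of fields thus reduce to equalities of
    coefficients. *)
Lemma witt_ext D E : (forall i, D 'X_i = E 'X_i) -> D = E.
Proof.
move=> DE; apply: derE => p.
elim/mpolyind: p => [|c m p _ _ IH]; first by rewrite !witt_0.
rewrite !witt_add IH !linearZ /=; congr (_ *: _ + _).
rewrite mpolyXE_id; apply: (big_ind (fun g => D g = E g)).
- by rewrite !witt_1.
- by move=> f g Df Dg; rewrite !witt_mul Df Dg.
move=> i _; elim: (m i) => [|k IHk]; first by rewrite !witt_1.
by rewrite exprS !witt_mul DE IHk.
Qed.

Definition partial i : witt F n := vecfield 1 i.

Lemma partialE i f : partial i f = f^`M(i).
Proof. by rewrite vecfieldE mul1r. Qed.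

Lemma lie_partialE i D l : [lie partial i, D] 'X_l = (D 'X_l)^`M(i).
Proof. by rewrite lieE !partialE mderivU witt_nat subr0. Qed.

Lemma lie_partial_vecfield i f j :
  [lie partial i, vecfield f j] = vecfield f^`M(i) j.
Proof.
apply: witt_ext => l; rewrite lie_partialE !vecfieldE mderivM mderivU.
by rewrite mderiv_nat mulr0 addr0.
Qed.

Lemma vecfield0 i : vecfield 0 i = 0.
Proof. by apply: witt_ext => l; rewrite vecfieldE mul0r. Qed.

Lemma vecfieldD f g i : vecfield (f + g) i = vecfield f i + vecfield g i.
Proof. by apply: witt_ext => l; rewrite wittDE !vecfieldE mulrDl. Qed.

Lemma lie_partials i j : [lie partial i, partial j] = 0.
Proof. by rewrite lie_partial_vecfield mderiv1 vecfield0. Qed.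

Lemma lie_partial_surj i D :
  [pchar F] =i pred0 -> exists E, D = [lie partial i, E].
Proof.
(* Bracketing with [partial i] differentiates each coefficient, so [E] is assembled from
   antiderivatives of the coefficients of [D]. *)
move=> F0; have /fin_all_exists[q qD] l := mderiv_surj i (D 'X_l) F0.
exists (\sum_l vecfield (q l) l); apply: witt_ext => j.
rewrite lie_partialE -qD; congr mderiv.
have -> : (\sum_l vecfield (q l) l) 'X_j = \sum_l vecfield (q l) l 'X_j.
  by elim/big_rec2: _ => // l ? ? _ <-.
rewrite (bigD1 j) //= big1 => [|l lj].
  by rewrite mderivU eqxx mulr1 addr0.
by rewrite mderivU eq_sym (negPf lj) mulr0.
Qed.

End WittAlgebra.

(** * Symmetric biderivations, from constant fields to all fields *)

Section SymmetricBiderivation.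
Variables (F : fieldType) (n : nat).
Hypothesis F0 : [pchar F] =i pred0.
Variable delta : witt F n -> witt F n -> witt F n.
Hypothesis delta_sb : symmetric_biderivation delta.
Implicit Types (i j k l m : 'I_n) (x y u v : witt F n).

Local Notation "''d_' i" := (partial F i) (at level 8, i at level 2).

Let deltaC x y : delta x y = delta y x.
Proof. by case: delta_sb. Qed.

Let delta_lier x y z :
  delta x [lie y, z] = [lie delta x y, z] + [lie y, delta x z].
Proof. by case: delta_sb => -[]. Qed.

Let delta_swap u v x y := biderivation_swap u v x y (proj1 delta_sb).

Let deltaDr x y z : delta x (y + z) = delta x y + delta x z.
Proof.
by case: delta_sb => -[[_ /(_ x 1 y z)] + _ _ _]; rewrite /= !scale1r.
Qed.

Let delta0r x : delta x 0 = 0.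
Proof. by apply: (addrI (delta x 0)); rewrite -deltaDr !addr0. Qed.

Lemma delta_partials_lie i j k f m :
  [lie delta 'd_i 'd_k, vecfield f^`M(j) m] =
  [lie delta 'd_j 'd_k, vecfield f^`M(i) m].
Proof.
have := delta_swap 'd_i (vecfield f m) 'd_j 'd_k.
by rewrite !lie_partials !lie0l !addr0 !lie_partial_vecfield.
Qed.

(** A polynomial in t_l alone is killed by d_i, so [delta_partials_lie] makes c = delta(d_i, d_k)
    commute with d_l and with 2 t_l d_l. The first makes c(t_l) independent of t_l; the second,
    evaluated at t_l, then gives 2 c(t_l) = 0. *)
Lemma delta_partials_offdiag i k l : l != i -> delta 'd_i 'd_k 'X_l = 0.
Proof.
move=> li; set c := delta _ _.
have c_const : (c 'X_l)^`M(l) = 0.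
  rewrite -lie_partialE lieC wittNE.
  have := delta_partials_lie i l k 'X_l l.
  by rewrite !mderivU eqxx (negPf li) vecfield0 lie0r => ->; rewrite oppr0.
have := delta_partials_lie i l k ('X_l * 'X_l) l.
rewrite !mderivM !mderivU eqxx (negPf li) mul0r mulr0 addr0 vecfield0 lie0r.
move/(congr1 (fun D : witt F n => D 'X_l)).
rewrite witt0E lieE !vecfieldE mderivU eqxx c_const mulr0 subr0 !mulr1 mul1r.
by rewrite witt_add -mulr2n; apply: natmulS_eq0.
Qed.

(** Works in the copy of sl_2 spanned by d, h = t d and e = t^2 d. Two Leibniz rules and one
    exchange identity, evaluated at t, form a linear differential system for the t-coefficients C, P
    of delta(d, d), delta(d, h) and the derivative R' of that of delta(d, e). *)
Lemma delta_partials_diag i : delta 'd_i 'd_i 'X_i = 0.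
Proof.
set t : {mpoly F[n]} := 'X_i; set d := 'd_i.
pose h : witt F n := vecfield t i; pose e : witt F n := vecfield (t * t) i.
have dt : t^`M(i) = 1 by rewrite mderivU eqxx.
have dh : [lie d, h] = d by rewrite lie_partial_vecfield dt.
have de : [lie d, e] = h + h.
  by rewrite lie_partial_vecfield mderivM dt mul1r mulr1 vecfieldD.
have he : [lie h, e] = e.
  apply: witt_ext => l; rewrite lieE !vecfieldE !mderivM dt mderivU.
  by rewrite mderiv_nat; ring.
have := delta_lier d d h; have := delta_lier d d e.
have := delta_swap d e h d.
rewrite (lieC h d) dh de he lie_partials lie0l addr0 deltaDr (deltaC h d).
set c := delta d d; set p := delta d h; set r := delta d e.
have d_t : d t = 1 by rewrite partialE dt.
have h_t : h t = t by rewrite vecfieldE dt mulr1.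
have e_t : e t = t * t by rewrite vecfieldE dt mulr1.
move=> /(congr1 (fun D : witt F n => D t)) E3.
move=> /(congr1 (fun D : witt F n => D t)) E2.
move=> /(congr1 (fun D : witt F n => D t)) E1.
move: E3 E2 E1.
rewrite !(wittDE, lieE, wittNE) d_t h_t e_t.
rewrite witt_opp !witt_add !witt_mul !witt_1 !(partialE, vecfieldE).
move: (c t) (p t) (r t)^`M(i) => C P R' E3 E2 E1.
have P'E : P^`M(i) = t * C^`M(i).
  by apply: (addrI (C - t * C^`M(i))); rewrite subrK [RHS]E1; ring.
have R'E : R' = P + P - (C * t + t * C - t * t * C^`M(i)) by rewrite E2; ring.
(* Eliminating R' and P' from [E3] leaves 4 (P - t C) = 0. Differentiating P = t C and comparing
   with P' = t C' then yields C = 0. *)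
have PE : P = t * C.
  apply/subr0_eq/(natmulS_eq0 (k := 3) F0).
  move/eqP: E3; rewrite -subr_eq0 R'E P'E => /eqP E3.
  by rewrite -[RHS]oppr0 -[in RHS]E3; ring.
by move: P'E; rewrite PE mderivM dt mul1r => /(canRL (addrK _)); rewrite subrr.
Qed.

Lemma delta_partials i k : delta 'd_i 'd_k = 0.
Proof.
apply: witt_ext => l; rewrite witt0E.
have [->|li] := eqVneq l i; last exact: delta_partials_offdiag.
have [<-|ik] := eqVneq i k; first exact: delta_partials_diag.
by rewrite deltaC delta_partials_offdiag.
Qed.

Lemma delta_partial_lie i k x :
  delta 'd_i [lie 'd_k, x] = [lie 'd_k, delta 'd_i x].
Proof. by rewrite delta_lier delta_partials lie0l add0r. Qed.

(** Says that delta(d_i, t_i d_l) has constant coefficients: ad d_k passes inside [delta] and turns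
    t_i d_l into d_l or 0. *)
Lemma lie_partial_delta_linear i k l :
  [lie 'd_k, delta 'd_i (vecfield 'X_i l)] = 0.
Proof.
rewrite -delta_partial_lie lie_partial_vecfield mderivU.
by case: (i == k); [exact: delta_partials | rewrite vecfield0 delta0r].
Qed.

Lemma delta_partial_lie_linear i k l x :
  delta 'd_k [lie 'd_l, x] = [lie [lie 'd_k, x], delta 'd_i (vecfield 'X_i l)].
Proof.
have := delta_swap 'd_i (vecfield 'X_i l) x 'd_k.
rewrite delta_partials lie_partials !lie0l add0r addr0.
rewrite lie_partial_vecfield mderivU eqxx (lieC x) lieNl lieC (deltaC x).
by rewrite delta_partial_lie (lieC 'd_l) => <-; rewrite opprK.
Qed.

Lemma delta_partial_linear l m : delta 'd_l (vecfield 'X_l m) = 0.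
Proof.
set t : {mpoly F[n]} := 'X_l.
have dt : t^`M(l) = 1 by rewrite mderivU eqxx.
set b := delta 'd_l (vecfield t l).
have b_const i j : (b 'X_i)^`M(j) = 0.
  by rewrite -lie_partialE lie_partial_delta_linear.
(* The field t^2 d_j is chosen because its bracket with d_l is 2 t d_j; the factor 2 is then
   cancelled. *)
have bE j : delta 'd_l (vecfield t j) = [lie vecfield t j, b].
  apply: subr0_eq; apply: (natmulS_eq0 (k := 1) F0).
  have := delta_partial_lie_linear l l l (vecfield (t * t) j).
  rewrite lie_partial_vecfield mderivM dt mul1r mulr1 vecfieldD deltaDr lieDl.
  by rewrite mulrnBl !mulr2n => ->; rewrite subrr.
(* At j = l, [bE] reads b = [t d_l, b]; at t, with b constant, this is b(t) = - b(t). *)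
have bt : b t = 0.
  apply: (natmulS_eq0 (k := 1) F0).
  have /(congr1 (fun D : witt F n => D t)) := bE l.
  rewrite lieE !vecfieldE dt mulr1 b_const mulr0 sub0r -/b => E.
  by rewrite mulr2n {1}E addNr.
rewrite bE; apply: witt_ext => i.
rewrite lieE !vecfieldE b_const witt_mul mderivU witt_nat bt.
by rewrite !mulr0 mul0r addr0 subr0.
Qed.

Lemma delta_partial i x : delta 'd_i x = 0.
Proof.
have [y ->] := lie_partial_surj i x F0.
by rewrite (delta_partial_lie_linear i) delta_partial_linear lie0r.
Qed.

Lemma delta_lie_partial k x y : delta x [lie 'd_k, y] = [lie 'd_k, delta x y].
Proof. by rewrite delta_lier deltaC delta_partial lie0l add0r. Qed.

(** Writing x = [d_i, y], the operator ad d_i moves through [delta] from the first argument to the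
    second, where it turns t_i d_m into d_m. *)
Lemma delta_linear i m x : delta x (vecfield 'X_i m) = 0.
Proof.
have [y ->] := lie_partial_surj i x F0.
rewrite deltaC delta_lie_partial deltaC -delta_lie_partial.
by rewrite lie_partial_vecfield mderivU eqxx deltaC delta_partial.
Qed.

(** In the exchange identity for d_m and t_m d_m, whose bracket is d_m, every other term contains a
    value of [delta] already known to vanish. *)
Lemma lie_delta_partial m x y : [lie delta x y, 'd_m] = 0.
Proof.
have := delta_swap 'd_m (vecfield 'X_m m) x y.
rewrite !delta_partial lie0l lie0r addr0 delta_linear lie0r addr0.
by rewrite lie_partial_vecfield mderivU eqxx.
Qed.

Lemma delta_eq0 : (0 < n)%N -> forall x y, delta x y = 0.
Proof.
move=> n_gt0 x y; pose m := Ordinal n_gt0.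
have [z ->] := lie_partial_surj m y F0.
by rewrite delta_lie_partial lieC lie_delta_partial oppr0.
Qed.

End SymmetricBiderivation.

Unset Implicit Arguments.

Theorem theorem4p3 (F : fieldType) (charF0 : [pchar F]%R =i pred0) (n : nat)
  (n_ge1 : (1 <= n)%N) (delta : witt F n -> witt F n -> witt F n)
  (delta_sb : symmetric_biderivation delta) (x y : witt F n) :
  delta x y = 0.
Proof. exact (delta_eq0 charF0 delta_sb n_ge1 x y). Qed.
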